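(* Let $\alpha=\alpha(\sigma):I\to\mathbb{E}_1^n$ be a non-null Frenet curve parameterized by a spherical arc length parameter $\sigma$, with Frenet frame $\mathbf{e}_1,\dots,\mathbf{e}_n$ and curvatures $\kappa_1,\dots,\kappa_{n-1}$. Then the pseudo-orthogonal frame $$\frac{1}{\kappa_1}\mathbf{e}_1(\sigma),\ \frac{1}{\kappa_1}\mathbf{e}_2(\sigma),\ \dots,\ \frac{1}{\kappa_1}\mathbf{e}_n(\sigma),\qquad \sigma\in I,$$ and the functions $\tilde\kappa_1=-\frac{1}{\kappa_1}\frac{d\kappa_1}{d\sigma}$, $\tilde\kappa_i=\frac{\kappa_i}{\kappa_1}$ $(i=2,3,\dots,n-1)$ are invariant under the group $\mathbf{Sim}^+(\mathbb{E}_1^n)$ of orientation-preserving p-similarities of the Minkowski $n$-space.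
   Context: $\mathbb{E}_1^n$ is $\mathbb{R}^n$ with the Lorentzian inner product $\mathbf{x}\cdot\mathbf{y}=\mathbf{x}^TI^*\mathbf{y}$, $I^*=\mathrm{diag}(-1,1,\dots,1)$, and $\|\mathbf{x}\|=\sqrt{|\mathbf{x}\cdot\mathbf{x}|}$. A p-similarity is a map $f(x)=\mu\mathbf{A}x+\mathbf{b}$ with $\mu\ne0$ a real constant, $\mathbf{A}$ a fixed pseudo-orthogonal $n\times n$ matrix with $\det\mathbf{A}=1$, and $\mathbf{b}$ a translation vector; it acts on vectors by its linear part $\vec f(\mathbf{u})=\mu\mathbf{A}\mathbf{u}$ and on curves by $\alpha\mapsto f\circ\alpha$. It is orientation-preserving (belongs to $\mathbf{Sim}^+(\mathbb{E}_1^n)$) when $n$ is odd and $\mu>0$, or $n$ is even and $\mu\neq0$. A non-null curve of class $C^n$ with arc length $s$ has a Frenet frame: a pseudo-orthonormal frame $\mathbf{e}_1,\dots,\mathbf{e}_n$ along it with $\mathbf{e}_1=d\alpha/ds$, $\varepsilon_\ell=-1$ if $\mathbf{e}_\ell$ is timelike and $\varepsilon_\ell=1$ if $\mathbf{e}_\ell$ is spacelike, satisfying $$\mathbf{e}_1'=\varepsilon_2\kappa_1\mathbf{e}_2,\quad \mathbf{e}_i'=-\varepsilon_{i-1}\kappa_{i-1}\mathbf{e}_{i-1}+\varepsilon_{i+1}\kappa_i\mathbf{e}_{i+1}\ (2\le i\le n-1),\quad \mathbf{e}_n'=-\varepsilon_{n-1}\kappa_{n-1}\mathbf{e}_{n-1},$$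 where $'=d/ds$, $\kappa_i=\mathbf{e}_i'\cdot\mathbf{e}_{i+1}$, $\kappa_j>0$ for $1\le j\le n-2$ and $\kappa_{n-1}\ne0$. A spherical arc length parameter $\sigma$ of $\alpha$ is an arc length parameter of the spherical tangent indicatrix $s\mapsto\mathbf{e}_1(s)$, so that $d\sigma=\kappa_1\,ds$ and $\frac{d\alpha}{d\sigma}=\frac1{\kappa_1}\mathbf{e}_1$. *)

(* Defs.v *)
From HB Require Import structures.
From mathcomp Require Import all_boot all_order all_algebra.
From mathcomp Require Import all_classical all_reals all_analysis.
Import Order.TTheory GRing.Theory Num.Theory numFieldNormedType.Exports.

Set Implicit Arguments.
Unset Strict Implicit.
Unset Printing Implicit Defensive.

Local Open Scope classical_set_scope.
Local Open Scope ring_scope.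

Section DerivativeWithin.
Variables (R : realType) (V : normedModType R).

(* Derivative of f relative to the set I: the increments h are restricted to
   x + h \in I, so it is one-sided at an endpoint of I. When I is a
   neighbourhood of x it is the derivative of the library, see
   is_derive_withinE. *)
Definition is_derive_within (I : set R) (f : R -> V) (x : R) (d : V) : Prop :=
  h^-1 *: (f (h + x) - f x) @[h --> within [set h | I (h + x)] 0^'] --> d.

Definition derive_within (I : set R) (f : R -> V) (x : R) : V :=
  lim (h^-1 *: (f (h + x) - f x) @[h --> within [set h | I (h + x)] 0^']).

Fixpoint Ck_within (k : nat) (I : set R) (f : R -> V) : Prop :=
  if k is k'.+1 then
    exists f' : R -> V,
      (forall x, I x -> is_derive_within I f x (f' x)) /\ Ck_within k' I f'
  else {within I, continuous f}.

Lemma is_derive_withinE (I : set R) (f : R -> V) (x : R) (d : V) :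
  nbhs x I -> is_derive_within I f x d <-> is_derive x 1 f d.
Proof.
move=> xI.
have -> : is_derive_within I f x d =
          (h^-1 *: (f (h + x) - f x) @[h --> 0^'] --> d).
  rewrite /is_derive_within; congr (_ `=>` _); congr fmap.
  apply/seteqP; split => A /=; rewrite /within /=; last first.
    by apply: filterS => h Ah _.
  move=> H; have H0 : \forall h \near (0 : R)^', I (h + x).
    apply: (@nbhs_dnbhs _ _ _); have : (h + x) @[h --> (0 : R)] --> x.
      by rewrite -[X in _ --> X]add0r; apply: cvgD; [exact: cvg_id|exact: cvg_cst].
    exact.
  change (\forall h \near (0 : R)^', I (h + x) -> A h) in H.
  change (\forall h \near (0 : R)^', A h).
  by apply: filterS (filterI H H0) => h [Hh Ih]; exact: Hh Ih.
have E : (fun h : R => h^-1 *: ((f \o shift x) (h *: 1) - f x)) =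
         (fun h => h^-1 *: (f (h + x) - f x)).
  by apply/funext => h /=; rewrite /GRing.scale /= mulr1.
split=> [H|[H <-]].
- by split; rewrite /derivable /derive E; [apply/cvg_ex; exists d | exact: cvg_lim H].
- by move: H; rewrite /derivable /derive E.
Qed.

End DerivativeWithin.

Section Minkowski.
Variables (R : realType) (n : nat).
Implicit Types (u v x y : 'cV[R]_n).

Definition Istar : 'M[R]_n :=
  diag_mx (\row_(j < n) if j == 0 :> nat then -1 else 1).

Definition lorentz x y : R := (x^T *m Istar *m y) 0 0.

Definition lnorm x : R := Num.sqrt `|lorentz x x|.

Definition timelike x : bool := lorentz x x < 0.

Definition causal_sign x : R := if timelike x then -1 else 1.

Definition pseudo_orthogonal_mx (A : 'M[R]_n) : Prop :=
  A^T *m Istar *m A = Istar.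

Record p_similarity := PSimilarity {
  psim_ratio : R;
  psim_mx : 'M[R]_n;
  psim_shift : 'cV[R]_n;
  psim_ratio_neq0 : psim_ratio != 0;
  psim_mx_orthogonal : pseudo_orthogonal_mx psim_mx;
  psim_det : \det psim_mx = 1 }.

Definition psim_linear (f : p_similarity) u : 'cV[R]_n :=
  psim_ratio f *: (psim_mx f *m u).

Definition psim_map (f : p_similarity) x : 'cV[R]_n :=
  psim_linear f x + psim_shift f.

Definition orientation_preserving (f : p_similarity) : bool :=
  if odd n then 0 < psim_ratio f else psim_ratio f != 0.

(* Frames are families u : nat -> 'cV[R]_n indexed from 1; only
   u 1, ..., u n are meaningful. *)
Definition pseudo_orthogonal_frame (u : nat -> 'cV[R]_n) : Prop :=
  forall i j, (1 <= i <= n)%N -> (1 <= j <= n)%N ->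
    (lorentz (u i) (u j) == 0) = (i != j).

Definition pseudo_orthonormal_frame (u : nat -> 'cV[R]_n) : Prop :=
  forall i j, (1 <= i <= n)%N -> (1 <= j <= n)%N ->
    lorentz (u i) (u j) = if i == j then causal_sign (u i) else 0.

Definition frame_mx (u : nat -> 'cV[R]_n) : 'M[R]_n :=
  \matrix_(i < n, j < n) u j.+1 i 0.

(* The Frenet equations do not distinguish (e_n, k_(n-1)) from
   (- e_n, - k_(n-1)); frames of different curves are therefore compared under
   a common choice of orientation. *)
Definition same_orientation (u v : nat -> 'cV[R]_n) : Prop :=
  0 < \det (frame_mx u) * \det (frame_mx v).

(* g is parametrized by arc length s \in J, with Frenet frame E and curvatures
   K (both indexed from 1). Unit speed is contained in frenet_tangent and
   frenet_orthonormal. *)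
Record frenet_arclength (J : set R) (g : R -> 'cV[R]_n)
    (E : nat -> R -> 'cV[R]_n) (K : nat -> R -> R) : Prop := FrenetArclength {
  frenet_class : Ck_within n J g;
  frenet_orthonormal : forall s, J s -> pseudo_orthonormal_frame (E ^~ s);
  frenet_tangent : forall s, J s -> is_derive_within J g s (E 1%N s);
  frenet_first : forall s, J s ->
    is_derive_within J (E 1%N) s ((causal_sign (E 2%N s) * K 1%N s) *: E 2%N s);
  frenet_middle : forall i s, (2 <= i <= n.-1)%N -> J s ->
    is_derive_within J (E i) s
      (- (causal_sign (E i.-1 s) * K i.-1 s) *: E i.-1 s
       + (causal_sign (E i.+1 s) * K i s) *: E i.+1 s);
  frenet_last : forall s, J s ->
    is_derive_within J (E n) s
      (- (causal_sign (E n.-1 s) * K n.-1 s) *: E n.-1 s);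
  frenet_curvature : forall i s d, (1 <= i <= n.-1)%N -> J s ->
    is_derive_within J (E i) s d -> K i s = lorentz d (E i.+1 s);
  frenet_pos : forall j s, (1 <= j <= n - 2)%N -> J s -> 0 < K j s;
  frenet_neq0 : forall s, J s -> K n.-1 s != 0 }.

(* alpha is a Frenet curve parametrized by a spherical arc length parameter
   sigma \in I, with frame e and curvatures k expressed in sigma; s is the arc
   length of alpha as a function of sigma and g the curve as a function of
   arc length. The indicatrix sigma |-> e 1 sigma has unit speed, and sigma is
   directed so that d sigma = k_1 ds. *)
Definition frenet_spherical (I : set R) (alpha : R -> 'cV[R]_n)
    (e : nat -> R -> 'cV[R]_n) (k : nat -> R -> R) : Prop :=
  exists (s : R -> R) (g : R -> 'cV[R]_n)
         (E : nat -> R -> 'cV[R]_n) (K : nat -> R -> R),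
  [/\ frenet_arclength (s @` I) g E K,
      forall sigma, I sigma ->
        [/\ alpha sigma = g (s sigma),
            forall i, (1 <= i <= n)%N -> e i sigma = E i (s sigma) &
            forall i, (1 <= i <= n.-1)%N -> k i sigma = K i (s sigma)],
      forall sigma, I sigma -> exists2 v,
        is_derive_within I (e 1%N) sigma v & lnorm v = 1 &
      forall sigma, I sigma ->
        is_derive_within I (s : R -> R^o) sigma (k 1%N sigma)^-1].

Definition similarity_curvature (I : set R) (k : nat -> R -> R)
    (i : nat) (sigma : R) : R :=
  if i == 1%N then
    - (k 1%N sigma)^-1 * derive_within I (k 1%N : R -> R^o) sigma
  else k i sigma / k 1%N sigma.

Definition similarity_frame (e : nat -> R -> 'cV[R]_n) (k : nat -> R -> R)
    (i : nat) (sigma : R) : 'cV[R]_n := (k 1%N sigma)^-1 *: e i sigma.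

End Minkowski.

(* Main.v *)
(* A p-similarity with linear part mu A multiplies arc length by |mu|, so the
   spherical arc length of alpha is also one of f o alpha. Differentiating
   f o alpha gives e'_1 = delta A e_1 with delta = mu k'_1 / k_1 = +-1, locally
   constant by continuity. Differentiating e'_i = delta A e_i and comparing
   Lorentzian squares then gives e'_(i+1) = +- delta A e_(i+1) and
   k'_i / k'_1 = +- k_i / k_1 with the same sign; the sign is + by positivity of
   the curvatures for i <= n - 2, and by the common orientation of the two
   frames for i = n - 1. *)

Require Import Defs.
From mathcomp Require Import all_boot all_order all_algebra.
From mathcomp Require Import all_classical all_reals all_analysis.
From mathcomp Require Import zify ring lra.
Import Order.TTheory GRing.Theory Num.Theory numFieldNormedType.Exports.

Set Implicit Arguments.
Unset Strict Implicit.
Unset Printing Implicit Defensive.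

Local Open Scope classical_set_scope.
Local Open Scope ring_scope.

(** * Limits along the increments that stay in a set *)

Section DerivativeWithin.
Variables (R : realType) (V : normedModType R).

(** The filter along which [is_derive_within] takes its limit. It is improper when [x] is isolated
    in [I], so properness is a separate hypothesis wherever uniqueness of derivatives matters. *)
Definition increments (I : set R) (x : R) : set_system R :=
  within [set h | I (h + x)] 0^'.

Lemma increments_filter (I : set R) (x : R) : Filter (increments I x).
Proof. exact: within_filter. Qed.

#[local] Existing Instance increments_filter.

Lemma near_increments_mem (I : set R) (x : R) :
  \forall h \near increments I x, I (h + x).
Proof. by rewrite /increments near_withinE; apply: nearW. Qed.

Lemma near_increments_neq0 (I : set R) (x : R) :
  \forall h \near increments I x, h != 0.
Proof.
rewrite /increments near_withinE.
by apply: filterS (nbhs_dnbhs_neq 0) => h h0 _.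
Qed.

Lemma cvg_increments_id (I : set R) (x : R) :
  h @[h --> increments I x] --> (0 : R).
Proof.
apply: cvg_trans (_ : h @[h --> (0 : R)^'] --> (0 : R)).
  exact: cvg_within.
by apply: cvg_within.
Qed.

(** A nondegenerate interval has no isolated point: from [x], a short move towards another point [y]
    of [I] stays in [I] by convexity. *)
Lemma is_interval_increments (I : set R) : is_interval I ->
  (exists a b, [/\ I a, I b & a < b]) ->
  forall x, I x -> ProperFilter (increments I x).
Proof.
move=> itvI [a [b [Ia Ib ab]]] x Ix.
apply: Build_ProperFilter_ex => P.
rewrite /increments /within /= /prop_near1 /dnbhs /within /=.
move=> /nbhs_ballP[r /= r0 rP].
have [y Iy xy] : exists2 y, I y & y != x.
  have [xa|xa] := eqVneq x a; first by exists b; rewrite // xa gt_eqF.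
  by exists a; rewrite // eq_sym.
have d0 : 0 < `|y - x| by rewrite normr_gt0 subr_eq0.
(* The bound 1 keeps [t * (y - x) + x] between [x] and [y]; the other bound keeps the increment
   within [r / 2] of 0. *)
pose t := Num.min 1 (r / 2 / `|y - x|).
have t0 : 0 < t by rewrite lt_min ltr01 /= !divr_gt0.
have t1 : t <= 1 by rewrite ge_min lexx.
exists (t * (y - x)); apply: rP.
- rewrite /ball /= sub0r normrN normrM gtr0_norm//.
  apply: (@le_lt_trans _ _ (r / 2));
    last by rewrite ltr_pdivrMr// ltr_pMr// ltr1n.
  by rewrite -ler_pdivlMr// ge_min lexx orbT.
- by apply: mulf_neq0; [rewrite gt_eqF|rewrite subr_eq0].
- have [yx|yx|yx] := ltgtP y x; last by rewrite yx eqxx in xy.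
  + apply: (itvI y x) => //; apply/andP; split.
      rewrite -subr_ge0 (_ : t * (y - x) + x - y = (1 - t) * (x - y));
      last by ring.
      by rewrite mulr_ge0 // subr_ge0 // ltW.
    by rewrite gerDr mulr_ge0_le0 ?ltW// subr_lt0.
  + apply: (itvI x y) => //; apply/andP; split.
      by rewrite lerDr mulr_ge0 ?ltW// subr_gt0.
    rewrite -subr_ge0 (_ : y - (t * (y - x) + x) = (1 - t) * (y - x));
      last by ring.
    by rewrite mulr_ge0 // subr_ge0 // ltW.
Qed.

Lemma is_derive_within_unique (I : set R) (f : R -> V) x d d' :
  ProperFilter (increments I x) ->
  is_derive_within I f x d -> is_derive_within I f x d' -> d = d'.
Proof.
by move=> ? fd fd'; apply: (cvg_unique _ fd fd'); exact: norm_hausdorff.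
Qed.

Lemma eq_is_derive_within (I : set R) (f g : R -> V) x d :
  (\forall h \near increments I x, f (h + x) = g (h + x)) -> f x = g x ->
  is_derive_within I f x d -> is_derive_within I g x d.
Proof.
move=> fg fgx; apply: cvg_trans; apply: near_eq_cvg.
by apply: filterS fg => h ->; rewrite fgx.
Qed.

Lemma is_derive_within_cvg (I : set R) (f : R -> V) x d :
  is_derive_within I f x d -> f (h + x) @[h --> increments I x] --> f x.
Proof.
move=> fd.
have H : h *: (h^-1 *: (f (h + x) - f x)) + f x @[h --> increments I x] -->
    (0 : R) *: d + f x.
  apply: cvgD; last exact: cvg_cst.
  by apply: cvgZ; [exact: cvg_increments_id|exact: fd].
rewrite scale0r add0r in H; apply: cvg_trans H; apply: near_eq_cvg.
apply: filterS (near_increments_neq0 I x) => h h0.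
by rewrite scalerA mulfV // scale1r subrK.
Qed.

End DerivativeWithin.
#[local] Existing Instance increments_filter.

(** * Chain rule for a change of parameter with nonzero derivative *)

Section ChainRule.
Variables (R : realType) (V : normedModType R).

(** A nonzero derivative keeps the difference quotient of [s] away from 0, so small nonzero
    increments of the parameter give nonzero increments of [s], as the punctured filter at [s x]
    demands. *)
Lemma is_derive_within_increments (I J : set R) (s : R -> R) x (c : R) :
  (forall y, I y -> J (s y)) -> c != 0 ->
  is_derive_within I (s : R -> R^o) x c ->
  s (h + x) - s x @[h --> increments I x] --> increments J (s x).
Proof.
move=> sIJ c0 sc P.
rewrite /increments /within /= /prop_near1 /dnbhs /within /= => JP.
have s0 : (s (h + x) - s x : R) @[h --> increments I x] --> (0 : R).
  rewrite -(subrr (s x)); apply: cvgB; last exact: cvg_cst.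
  exact: (is_derive_within_cvg sc).
have := s0 _ JP; rewrite /= /fmap /=.
apply: filterS3 (near_increments_mem I x) (cvgr_neq0 _ sc c0) => h Ih /= s_neq0.
move=> H; apply: H; last by rewrite subrK; exact: sIJ.
by apply: contra_neq s_neq0 => ->; rewrite scaler0.
Qed.

(** A filter that receives a limit from a proper filter is proper. This gives unique derivatives on
    the range of an arc length function. *)
Lemma increments_proper_image (I J : set R) (s : R -> R) x (c : R) :
  (forall y, I y -> J (s y)) -> c != 0 ->
  is_derive_within I (s : R -> R^o) x c ->
  ProperFilter (increments I x) -> ProperFilter (increments J (s x)).
Proof.
move=> sIJ c0 sc PI; have H := is_derive_within_increments sIJ c0 sc.
apply: Build_ProperFilter => /H; rewrite /fmap /= => H0.
by have [] := @filter_ex _ _ PI _ H0.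
Qed.

(** The quotient of [g \o s] is the product of those of [s] and [g], since the increment of [s] is
    eventually nonzero. *)
Lemma is_derive_within_comp (I J : set R) (s : R -> R) (g : R -> V) x (c : R)
    d :
  (forall y, I y -> J (s y)) -> c != 0 ->
  is_derive_within I (s : R -> R^o) x c -> is_derive_within J g (s x) d ->
  is_derive_within I (g \o s) x (c *: d).
Proof.
move=> sIJ c0 sc gd.
have gsd := cvg_comp _ _ (is_derive_within_increments sIJ c0 sc) gd.
apply: cvg_trans (cvgZ sc gsd); apply: near_eq_cvg.
apply: filterS (cvgr_neq0 _ sc c0) => h /= s_neq0.
rewrite subrK scalerA -[h^-1 *: (s _ - _)]/(h^-1 * _) -mulrA mulfV ?mulr1 //.
by apply: contra_neq s_neq0 => ->; rewrite scaler0.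
Qed.

Lemma is_derive_within_scaling (I : set R) (s : R -> R) x (c m : R) :
  is_derive_within I (s : R -> R^o) x c ->
  is_derive_within I ((fun y => m * s y) : R -> R^o) x (m * c).
Proof.
move=> sc; apply: cvg_trans (cvgZl_tmp (k := m) sc); apply: near_eq_cvg.
by apply: nearW => h /=; rewrite -mulrBr /GRing.scale /= mulrCA.
Qed.

Lemma is_derive_within_mul (I : set R) (m x : R) :
  is_derive_within I ((fun y => m * y) : R -> R^o) x m.
Proof.
rewrite -[X in is_derive_within _ _ _ X]mulr1.
apply: (@is_derive_within_scaling I id).
have one : (fun=> 1 : R^o) h @[h --> increments I x] --> (1 : R^o).
  exact: cvg_cst.
apply: cvg_trans one; apply: near_eq_cvg.
apply: filterS (near_increments_neq0 I x) => h h0.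
by rewrite addrK /GRing.scale /= mulVf.
Qed.

End ChainRule.

(* No differentiability is assumed: a divergent limit has the value 0. *)
Lemma derive_within_scale (R : realType) (I : set R) (f g : R -> R^o) x
    (c : R) :
  ProperFilter (increments I x) -> c != 0 ->
  (\forall h \near increments I x, g (h + x) = c *: f (h + x)) ->
  g x = c *: f x ->
  derive_within I g x = c *: derive_within I f x.
Proof.
move=> PF c0 gf gfx; rewrite /derive_within -/(increments I x).
pose F h : R^o := h^-1 *: (f (h + x) - f x).
pose G h : R^o := h^-1 *: (g (h + x) - g x).
have FG : \forall h \near increments I x, G h = c *: F h.
  apply: filterS gf => h; rewrite /G /F gfx => ->.
  by rewrite -scalerBr !scalerA mulrC.
rewrite -/F -/G.
have [cF|dF] := pselect (cvg (F h @[h --> increments I x])).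
  apply: cvg_lim; first exact: norm_hausdorff.
  apply: cvg_trans (cvgZl_tmp (k := c) cF); apply: near_eq_cvg.
  by apply: filterS FG.
rewrite (dvgP dF) dvgP => [|cG]; first by rewrite [RHS]scaler0.
apply: dF.
apply/cvg_ex; exists (c^-1 *: lim (G h @[h --> increments I x])).
apply: cvg_trans (cvgZl_tmp (k := c^-1) cG); apply: near_eq_cvg.
by apply: filterS FG => h /= ->; rewrite scalerA mulVf // scale1r.
Qed.

(** * Limits and derivatives under affine maps *)

Section MulmxWithin.
Variables (R : realType) (m n : nat).
Implicit Types (A : 'M[R]_(m, n)) (I : set R).

Lemma mulmx_cvg (T : Type) (F : set_system T) {FF : Filter F} A
    (u : T -> 'cV[R]_n) (l : 'cV[R]_n) :
  u t @[t --> F] --> l -> A *m u t @[t --> F] --> A *m l.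
Proof.
move=> ul.
(* As a combination of fixed columns, [A *m v] depends on [v] only through scalar coordinates, which
   are continuous. *)
have E (v : 'cV[R]_n) : A *m v = \sum_(k < n) v k 0 *: col k A.
  apply/colP => i; rewrite !mxE summxE; apply: eq_bigr => k _.
  by rewrite !mxE mulrC.
have -> : (fun t => A *m u t) = fun t => \sum_(k < n) u t k 0 *: col k A.
  by apply/funext => t; exact: E.
rewrite E.
apply: cvg_big => [|k _]; first exact: add_continuous.
apply: cvgZr_tmp; exact: (cvg_comp _ _ ul (coord_continuous (x := l))).
Qed.

Lemma is_derive_within_mulmx I A (f : R -> 'cV[R]_n) x d b :
  is_derive_within I f x d ->
  is_derive_within I (fun y => A *m f y + b) x (A *m d).
Proof.
move=> fd; apply: cvg_trans (mulmx_cvg (A := A) fd); apply: near_eq_cvg.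
apply: nearW => h /=.
by rewrite [A *m f x + b]addrC opprD addrA addrK -mulmxBr scalemxAr.
Qed.

End MulmxWithin.

(** * Lorentzian algebra: isometries, unit vectors, Gram matrices *)

Section Lorentz.
Variables (R : realType) (n : nat).
Implicit Types (x y u v : 'cV[R]_n) (A : 'M[R]_n).

Lemma lorentzZ (a b : R) x y : lorentz (a *: x) (b *: y) = a * b * lorentz x y.
Proof.
have T : (a *: x)^T = a *: x^T by rewrite linearZ.
by rewrite /lorentz T -!scalemxAl -scalemxAr !mxE mulrA.
Qed.

Lemma lorentz_mulmx A x y : pseudo_orthogonal_mx A ->
  lorentz (A *m x) (A *m y) = lorentz x y.
Proof.
move=> AA; rewrite /lorentz -[in RHS]AA trmx_mul.
by rewrite !mulmxA.
Qed.

Lemma lorentz_causal_sign x y : lorentz x x = lorentz y y ->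
  causal_sign x = causal_sign y.
Proof. by rewrite /causal_sign /timelike => ->. Qed.

Lemma causal_sign_sqr x : causal_sign x * causal_sign x = 1.
Proof. by rewrite /causal_sign; case: ifP; rewrite ?mulrNN mulr1. Qed.

Lemma causal_sign_neq0 x : causal_sign x != 0.
Proof. by rewrite -sqrf_eq0 expr2 causal_sign_sqr oner_eq0. Qed.

(* The Lorentzian squares a^2 * cs u and b^2 * cs v agree, which rules out
   opposite causal characters. *)
Lemma unit_proportional u v (a b : R) :
  lorentz u u = causal_sign u -> lorentz v v = causal_sign v ->
  (causal_sign u * a) *: u = (causal_sign v * b) *: v -> b != 0 ->
  exists t, [/\ t * t = 1, a = t * b & u = t *: v].
Proof.
move=> uu vv uv b0.
have := congr1 (fun w => lorentz w w) uv; rewrite /= !lorentzZ uu vv.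
have bb : 0 < b * b by rewrite -expr2 exprn_even_gt0.
have aa : 0 <= a * a by rewrite -expr2 exprn_even_ge0.
have E : causal_sign u * a * (causal_sign u * a) * causal_sign u =
         causal_sign v * b * (causal_sign v * b) * causal_sign v ->
    causal_sign u = causal_sign v /\ a * a = b * b.
  by rewrite /causal_sign; case: ifP => _; case: ifP => _ H; split=> //; lra.
move=> /E[uvs ab].
have tt : a / b * (a / b) = 1 by rewrite mulf_div ab divff // gt_eqF.
exists (a / b); split=> //; first by rewrite divfK.
move: uv; rewrite uvs -!scalerA => /(scalerI (causal_sign_neq0 v)) auv.
have -> : v = b^-1 *: (a *: u) by rewrite auv scalerA mulVf // scale1r.
by rewrite !scalerA -mulrA [b^-1 * a]mulrC tt scale1r.
Qed.

Lemma frame_mx_gram (u : nat -> 'cV[R]_n) i j :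
  ((frame_mx u)^T *m Istar R n *m frame_mx u) i j = lorentz (u i.+1) (u j.+1).
Proof.
have E l : col l (frame_mx u) = u l.+1 by apply/colP => m; rewrite !mxE.
rewrite /lorentz -(E i) -(E j) tr_col -row_mul mxE [RHS]mxE.
by apply: eq_bigr => l _; rewrite [row _ _ _ _]mxE [col _ _ _ _]mxE.
Qed.

(** The Gram matrix of the frame is diagonal with entries 1 or -1, and its determinant has
    [\det (frame_mx u)] as a factor. *)
Lemma det_frame_mx_neq0 (u : nat -> 'cV[R]_n) :
  pseudo_orthonormal_frame u -> \det (frame_mx u) != 0.
Proof.
move=> uu.
have E : (frame_mx u)^T *m Istar R n *m frame_mx u =
         diag_mx (\row_(j < n) causal_sign (u j.+1)).
  apply/matrixP => i j; rewrite frame_mx_gram !mxE uu ?ltn_ord //.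
  by rewrite eqSS -val_eqE /=; case: eqP => [->|]; rewrite ?mulr1n ?mulr0n.
have := congr1 determinant E; rewrite det_diag !det_mulmx => D.
suff : \prod_i (\row_(j < n) causal_sign (u j.+1)) 0 i != 0.
  by rewrite -D mulf_eq0 negb_or => /andP[].
by apply/prodf_neq0 => i _; rewrite mxE causal_sign_neq0.
Qed.

End Lorentz.

(** * Frenet equations in the spherical arc length parameter *)

Section SphericalEquations.
Variables (R : realType) (n : nat).

(** The component of the derivative of [e i] along its predecessor. The value 0 at [i = 1] lets the
    first and middle Frenet equations share one formula. *)
Definition frenet_backward (e : nat -> R -> 'cV[R]_n) (k : nat -> R -> R)
    (i : nat) (sigma : R) : 'cV[R]_n :=
  if i == 1%N then 0 else
  - (causal_sign (e i.-1 sigma) * (k i.-1 sigma / k 1%N sigma)) *: e i.-1 sigma.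

(** The Frenet equations divided by the first curvature, free of the arc length. Derivatives stop at
    index [n.-1] because each [e i] is differentiated to reach [e i.+1]. *)
Record spherical_equations (I : set R) (alpha : R -> 'cV[R]_n)
    (e : nat -> R -> 'cV[R]_n) (k : nat -> R -> R) : Prop := {
  spherical_orthonormal : forall x, I x -> pseudo_orthonormal_frame (e ^~ x);
  spherical_tangent : forall x, I x ->
    is_derive_within I alpha x ((k 1%N x)^-1 *: e 1%N x);
  spherical_derive : forall i x, (1 <= i <= n.-1)%N -> I x ->
    is_derive_within I (e i) x (frenet_backward e k i x +
      (causal_sign (e i.+1 x) * (k i x / k 1%N x)) *: e i.+1 x);
  spherical_pos : forall i x, (1 <= i <= n - 2)%N -> I x -> 0 < k i x;
  spherical_neq0 : forall i x, (1 <= i <= n.-1)%N -> I x -> k i x != 0 }.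

(** The arc length has derivative [(k 1%N x)^-1] in the spherical parameter, so the chain rule
    divides every Frenet equation by [k 1%N x]. *)
Lemma frenet_spherical_equations (I : set R) alpha e k : (2 <= n)%N ->
  frenet_spherical I alpha e k -> spherical_equations I alpha e k.
Proof.
move=> n2 [s [g [E [K [[_ EE gE E1 Ei En _ Kpos Kn0] sE _ s']]]]].
have IJ y : I y -> (s @` I) (s y) by move=> Iy; exists y.
have kn0 i x : (1 <= i <= n.-1)%N -> I x -> k i x != 0.
  move=> /andP[i1 iin] Ix; have [_ _ ->] := sE _ Ix; last by rewrite i1.
  (* Positivity stops at [n - 2]; the last curvature is only nonzero. For [n = 2] that one is the
     first curvature. *)
  have [iin2|iin2] := leqP i (n - 2).
    by rewrite gt_eqF // Kpos ?i1 //; exact: IJ.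
  have -> : i = n.-1 by lia.
  exact/Kn0/IJ.
have k1n0 x : I x -> k 1%N x != 0 by move=> Ix; apply: kn0 => //; lia.
have eqE i x : (1 <= i <= n)%N -> I x -> e i x = E i (s x).
  by move=> ii Ix; have [_ ->] := sE _ Ix.
have eqK i x : (1 <= i <= n.-1)%N -> I x -> k i x = K i (s x).
  by move=> ii Ix; have [_ _ ->] := sE _ Ix.
have chain (V : normedModType R) (F G : R -> V) d x : I x ->
    (forall y, I y -> F y = G (s y)) ->
    is_derive_within (s @` I) G (s x) d ->
    is_derive_within I F x ((k 1%N x)^-1 *: d).
  move=> Ix FG Gd.
  have := is_derive_within_comp IJ (invr_neq0 (k1n0 _ Ix)) (s' _ Ix) Gd.
  apply: eq_is_derive_within; last by rewrite FG.
  by apply: filterS (near_increments_mem I x) => h Ih; rewrite FG.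
split=> //.
- move=> x Ix i j ii jj; rewrite !eqE //; exact: EE (IJ _ Ix) _ _ ii jj.
- move=> x Ix; rewrite eqE ?(leq_trans _ n2) //.
  by apply: (chain _ _ g) => // [y Iy|]; [have [->] := sE _ Iy|exact/gE/IJ].
- move=> i x ii Ix.
  have iin : (1 <= i <= n)%N by lia.
  have eE y : I y -> e i y = E i (s y) by exact: eqE.
  have i1in : (1 <= i.+1 <= n)%N by lia.
  have [i1|i1] := eqVneq i 1%N.
    have h1 : (1 <= 1 <= n.-1)%N by lia.
    have := chain _ _ _ _ _ Ix eE; rewrite i1 => /(_ _ (E1 _ (IJ _ Ix))).
    congr (is_derive_within _ _ _ _).
    rewrite /frenet_backward eqxx add0r (eqE 2%N) // -(eqK 1%N) //.
    by rewrite divff ?k1n0 // mulr1 scalerA mulrCA mulVf ?k1n0 ?mulr1.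
  have i1n : (1 <= i.-1 <= n.-1)%N by lia.
  have i1n' : (1 <= i.-1 <= n)%N by lia.
  have i2 : (2 <= i <= n.-1)%N by lia.
  have := chain _ _ _ _ _ Ix eE (Ei i _ i2 (IJ _ Ix)).
  congr (is_derive_within _ _ _ _).
  rewrite /frenet_backward (negbTE i1) (eqE i.+1) // (eqE i.-1) //.
  rewrite -(eqK i) // -(eqK i.-1) // scalerDr !scalerA.
  by congr (_ *: _ + _ *: _); ring.
- move=> i x ii Ix; have ii' : (1 <= i <= n.-1)%N by lia.
  by rewrite eqK // Kpos //; exact: IJ.
Qed.

End SphericalEquations.

Lemma sqr_eq1_gt0 (R : realDomainType) (t : R) : t * t = 1 -> 0 < t -> t = 1.
Proof.
move=> tt t0; apply/eqP; rewrite -(@eqrXn2 _ 2) ?ltW //.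
by rewrite expr2 tt expr1n.
Qed.

(** * Comparison of a curve with its image under a p-similarity *)

Section SimilarCurves.
Variables (R : realType) (n : nat) (I : set R) (alpha : R -> 'cV[R]_n).
Variables (e e' : nat -> R -> 'cV[R]_n) (k k' : nat -> R -> R).
Variable f : p_similarity R n.
Hypothesis n2 : (2 <= n)%N.
Hypothesis properI : forall x, I x -> ProperFilter (increments I x).
Hypothesis eqs : spherical_equations I alpha e k.
Hypothesis eqs' : spherical_equations I (psim_map f \o alpha) e' k'.

Local Notation mu := (psim_ratio f).
Local Notation A := (psim_mx f).

(** This turns out to be 1 or -1. For [n >= 3] it is the sign of [mu]; for [n = 2] the first
    curvatures may be negative, so it may differ from that sign. *)
Definition tangent_sign (x : R) : R := mu * k' 1%N x / k 1%N x.

Local Notation delta := tangent_sign.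

Let k1_neq0 x : I x -> k 1%N x != 0.
Proof. by move=> Ix; apply: (spherical_neq0 eqs) => //; lia. Qed.

Let k'1_neq0 x : I x -> k' 1%N x != 0.
Proof. by move=> Ix; apply: (spherical_neq0 eqs') => //; lia. Qed.

Let unit_e i x : (1 <= i <= n)%N -> I x ->
  lorentz (e i x) (e i x) = causal_sign (e i x).
Proof. by move=> ii Ix; rewrite (spherical_orthonormal eqs) // eqxx. Qed.

Let unit_e' i x : (1 <= i <= n)%N -> I x ->
  lorentz (e' i x) (e' i x) = causal_sign (e' i x).
Proof. by move=> ii Ix; rewrite (spherical_orthonormal eqs') // eqxx. Qed.

(** Both curves have the same parameter, so the derivative of the image curve is found twice:
    through the affine map and from its own tangent equation. *)
Lemma similar_tangent x : I x -> e' 1%N x = delta x *: (A *m e 1%N x).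
Proof.
move=> Ix.
have d := is_derive_within_mulmx (A := mu *: A) (psim_shift f)
  (spherical_tangent eqs Ix).
have E : (fun y => mu *: A *m alpha y + psim_shift f) = psim_map f \o alpha.
  by apply/funext => y; rewrite /psim_map /psim_linear /= scalemxAl.
rewrite E in d.
have PI := properI Ix.
have := is_derive_within_unique PI d (spherical_tangent eqs' Ix).
move=> /(congr1 (fun v => k' 1%N x *: v)).
rewrite scalerA divff ?k'1_neq0 // scale1r => <-.
rewrite -scalemxAl -scalemxAr !scalerA; congr (_ *: _).
by rewrite /delta; ring.
Qed.

(** [A] preserves Lorentzian squares and both tangents have square 1 or -1; as [delta x * delta x]
    is nonnegative, the two squares agree. *)
Lemma tangent_sign_sqr x : I x -> delta x * delta x = 1.
Proof.
move=> Ix; have i1 : (1 <= 1 <= n)%N by lia.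
have := unit_e' i1 Ix; rewrite {1 2}(similar_tangent Ix) lorentzZ.
rewrite (lorentz_mulmx _ _ (psim_mx_orthogonal f)) unit_e //.
have : 0 <= delta x * delta x by rewrite -expr2 sqr_ge0.
by rewrite /causal_sign; case: ifP => _; case: ifP => _ ? ?; lra.
Qed.

Let lorentz_similar x u v : I x ->
  lorentz (delta x *: (A *m u)) (delta x *: (A *m v)) = lorentz u v.
Proof.
move=> Ix; rewrite lorentzZ tangent_sign_sqr // mul1r lorentz_mulmx //.
exact: psim_mx_orthogonal.
Qed.

Lemma tangent_sign_neq0 x : I x -> delta x != 0.
Proof. by move=> Ix; rewrite -sqrf_eq0 expr2 tangent_sign_sqr ?oner_eq0. Qed.

(* The tangents e_1 and e'_1 are continuous, so the sign cannot jump. *)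
Lemma near_tangent_sign x : I x ->
  \forall h \near increments I x, delta (h + x) = delta x.
Proof.
move=> Ix; have i1 : (1 <= 1 <= n.-1)%N by lia.
have c := is_derive_within_cvg (spherical_derive eqs i1 Ix).
have c' := is_derive_within_cvg (spherical_derive eqs' i1 Ix).
have cA : delta x *: (A *m e 1%N (h + x)) @[h --> increments I x] -->
    delta x *: (A *m e 1%N x) by apply: cvgZl_tmp; apply: mulmx_cvg.
(* This sum tends to [2 *: e' 1%N x], which is nonzero, yet it would vanish wherever the sign had
   flipped. *)
have : e' 1%N (h + x) + delta x *: (A *m e 1%N (h + x))
    @[h --> increments I x] --> e' 1%N x + delta x *: (A *m e 1%N x).
  exact: cvgD.
move=> /cvgr_neq0.
have -> : e' 1%N x + delta x *: (A *m e 1%N x) = 2 *: e' 1%N x.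
  by rewrite -similar_tangent // -[X in X + X]scale1r -scalerDl.
have e'n0 : 2 *: e' 1%N x != 0.
  rewrite scaler_eq0 negb_or pnatr_eq0 /=.
  apply: contra_neq (causal_sign_neq0 (e' 1%N x)) => e'0.
  by rewrite -unit_e' //; [rewrite e'0 -(scale0r 0) lorentzZ !mul0r|lia].
move=> /(_ e'n0).
apply: filterS2 (near_increments_mem I x) => h Ih /=.
rewrite (similar_tangent Ih) -scalerDl => dd.
have : (delta (h + x) - delta x) * (delta (h + x) + delta x) = 0.
  by rewrite -subr_sqr !expr2 !tangent_sign_sqr // subrr.
move/eqP; rewrite mulf_eq0 subr_eq0 => /orP[/eqP//|/eqP d0].
by rewrite d0 scale0r eqxx in dd.
Qed.

Definition similar_at (i : nat) (x : R) : Prop :=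
  e' i x = delta x *: (A *m e i x).

Lemma similar_derive i x d : (forall y, I y -> similar_at i y) -> I x ->
  is_derive_within I (e i) x d ->
  is_derive_within I (e' i) x (delta x *: (A *m d)).
Proof.
move=> simi Ix ed.
have := is_derive_within_mulmx (A := delta x *: A) 0 ed.
rewrite -scalemxAl; apply: eq_is_derive_within.
  apply: filterS2 (near_increments_mem I x) (near_tangent_sign Ix) => h Ih dh.
  by rewrite addr0 simi // dh scalemxAl.
by rewrite addr0 simi // scalemxAl.
Qed.

(** Two expressions for the derivative of [e' i] agree. Cancelling the backward terms leaves
    proportional unit vectors, to which [unit_proportional] applies. *)
Lemma similar_next i x : (1 <= i <= n.-1)%N ->
  (forall y, I y -> similar_at i y) -> I x ->
  frenet_backward e' k' i x = delta x *: (A *m frenet_backward e k i x) ->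
  exists t, [/\ t * t = 1, k' i x / k' 1%N x = t * (k i x / k 1%N x) &
    e' i.+1 x = t *: (delta x *: (A *m e i.+1 x))].
Proof.
move=> ii simi Ix back; have i1 : (1 <= i.+1 <= n)%N by lia.
have PI := properI Ix.
have d := similar_derive simi Ix (spherical_derive eqs ii Ix).
have := is_derive_within_unique PI d (spherical_derive eqs' ii Ix).
rewrite back mulmxDr scalerDr => /addrI.
rewrite -scalemxAr scalerA mulrC => /esym E.
have C := lorentz_causal_sign (lorentz_similar (e i.+1 x) (e i.+1 x) Ix).
apply: unit_proportional.
- exact: unit_e'.
- by rewrite lorentz_similar // C unit_e.
- by rewrite C scalerA.
- by apply: mulf_neq0; rewrite ?invr_neq0 ?k1_neq0 // (spherical_neq0 eqs ii).
Qed.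

Lemma curvature_ratio_gt0 (v : nat -> R -> 'cV[R]_n) (c : nat -> R -> R) beta
    i x :
  spherical_equations I beta v c -> (1 <= i <= n - 2)%N -> I x ->
  0 < c i x / c 1%N x.
Proof.
by move=> H ii Ix; rewrite divr_gt0 // (spherical_pos H) //; lia.
Qed.

Lemma similar_next_pos i x : (1 <= i <= n - 2)%N ->
  (forall y, I y -> similar_at i y) -> I x ->
  frenet_backward e' k' i x = delta x *: (A *m frenet_backward e k i x) ->
  k' i x / k' 1%N x = k i x / k 1%N x /\ similar_at i.+1 x.
Proof.
move=> ii simi Ix back; have ii' : (1 <= i <= n.-1)%N by lia.
have [t [tt kt et]] := similar_next ii' simi Ix back.
suff t1 : t = 1 by rewrite kt /similar_at et t1 mul1r scale1r.
have := curvature_ratio_gt0 eqs' ii Ix; rewrite kt pmulr_lgt0; last first.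
  exact: (curvature_ratio_gt0 eqs ii Ix).
exact: sqr_eq1_gt0.
Qed.

(** The induction carries both claims: the backward term at [i.+1] involves [e i] and the ratio of
    curvatures found at stage [i]. Each stage has [i <= n - 2], where positivity fixes the sign. *)
Lemma similar_frame_lt i : (1 <= i <= n.-1)%N ->
  (forall x, I x -> similar_at i x) /\
  (forall x, I x ->
   frenet_backward e' k' i x = delta x *: (A *m frenet_backward e k i x)).
Proof.
elim: i => // i IH ii; have [i0|i0] := posnP i.
  rewrite i0; split=> x Ix; first exact: similar_tangent.
  by rewrite /frenet_backward /= mulmx0 scaler0.
have [simi back] := IH ltac:(lia).
have ii2 : (1 <= i <= n - 2)%N by lia.
split=> x Ix; have [kk si1] := similar_next_pos ii2 simi Ix (back _ Ix) => //.
rewrite /frenet_backward eqSS (gtn_eqF i0) /= kk (simi x Ix).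
have -> : causal_sign (delta x *: (A *m e i x)) = causal_sign (e i x).
  exact/lorentz_causal_sign/lorentz_similar.
by rewrite -scalemxAr !scalerA mulrC.
Qed.

Hypothesis orient : orientation_preserving f.

(** This is the determinant of [delta x *: A]. Even powers of a sign are 1; for odd [n] the ratio
    [mu] is positive. *)
Lemma tangent_sign_expn x : I x -> delta x ^+ n = 1.
Proof.
move=> Ix; have dd := tangent_sign_sqr Ix.
rewrite -[n in _ ^+ n]odd_double_half -muln2 mulnC exprD exprM expr2 dd.
rewrite expr1n mulr1.
have [nodd|_] := boolP (odd n); last by rewrite expr0.
(* An odd [n] with [2 <= n] is at least 3, so the first curvatures are positive. *)
have n3 : (1 <= 1 <= n - 2)%N by move: nodd n2; case: (n) => [|[|[|]]].
move: orient; rewrite /orientation_preserving nodd => mu0.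
rewrite expr1; apply: sqr_eq1_gt0 => //; rewrite /tangent_sign.
by rewrite divr_gt0 ?mulr_gt0 ?(spherical_pos eqs') ?(spherical_pos eqs).
Qed.

(** Positivity says nothing about the last sign [t]. The frame determinants differ by the factor
    [t], so the common orientation forces [t = 1]. *)
Lemma similar_frame_last x : I x -> same_orientation (e ^~ x) (e' ^~ x) ->
  k' n.-1 x / k' 1%N x = k n.-1 x / k 1%N x /\ similar_at n x.
Proof.
move=> Ix ori; have nn : (1 <= n.-1 <= n.-1)%N by lia.
have [simi back] := similar_frame_lt nn.
have [t [tt kt et]] := similar_next nn simi Ix (back _ Ix).
rewrite prednK in et; last by lia.
suff t1 : t = 1 by rewrite kt /similar_at et t1 mul1r scale1r.
(* Column [j] holds the frame vector of index [j.+1], so only the last column carries [t]. *)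
have E : frame_mx (e' ^~ x) = delta x *: A *m frame_mx (e ^~ x) *m
    diag_mx (\row_(j < n) if j.+1 == n then t else 1).
  have col_e i j : (delta x *: A *m frame_mx (e ^~ x)) i j =
      (delta x *: (A *m e j.+1 x)) i 0.
    rewrite -scalemxAl !mxE; congr (_ * _).
    by apply: eq_bigr => l _; rewrite !mxE.
  apply/matrixP => i j.
  rewrite mul_mx_diag [LHS]mxE [RHS]mxE col_e [X in _ * X]mxE.
  have [jn|jn] := eqVneq j.+1 n; first by rewrite jn et [LHS]mxE mulrC.
  have jj : (1 <= j.+1 <= n.-1)%N by move: (ltn_ord j) jn; lia.
  by rewrite ((similar_frame_lt jj).1 _ Ix) mulr1.
have D : \prod_(j < n) (if j.+1 == n then t else 1) = t.
  have nn' : (n.-1 < n)%N by lia.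
  rewrite (bigD1 (Ordinal nn')) //= prednK; last by lia.
  rewrite eqxx big1 ?mulr1 // => j; rewrite -val_eqE /= => jn.
  by case: eqP => // jn'; exfalso; lia.
move: ori; rewrite /same_orientation E !det_mulmx detZ psim_det mulr1.
rewrite tangent_sign_expn // mul1r det_diag.
under eq_bigr do rewrite mxE.
rewrite D mulrA => F0.
apply: sqr_eq1_gt0 => //; rewrite ltNge; apply/negP => t0.
by move: F0; rewrite ltNge mulr_ge0_le0 // -expr2 sqr_ge0.
Qed.

Hypothesis same_ori : forall x, I x -> same_orientation (e ^~ x) (e' ^~ x).

Lemma similar_similarity_frame i x : (1 <= i <= n)%N -> I x ->
  psim_linear f (similarity_frame e k i x) = similarity_frame e' k' i x.
Proof.
move=> ii Ix.
have sim : similar_at i x.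
  have [->|i_n] := eqVneq i n.
    exact: (similar_frame_last Ix (same_ori Ix)).2.
  have ii' : (1 <= i <= n.-1)%N by lia.
  exact: (similar_frame_lt ii').1.
rewrite /psim_linear /similarity_frame sim -scalemxAr !scalerA; congr (_ *: _).
by rewrite /tangent_sign -mulrA mulrCA mulKf ?k'1_neq0 // [RHS]mulrC.
Qed.

Lemma similar_similarity_curvature i x : (1 <= i <= n.-1)%N -> I x ->
  similarity_curvature I k i x = similarity_curvature I k' i x.
Proof.
move=> ii Ix; rewrite /similarity_curvature.
have [i1|i1] := eqVneq i 1%N; last first.
  have [->|i_n] := eqVneq i n.-1.
    by rewrite (similar_frame_last Ix (same_ori Ix)).1.
  have ii' : (1 <= i <= n - 2)%N by lia.
  have [simi back] := similar_frame_lt ii.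
  by rewrite (similar_next_pos ii' simi Ix (back _ Ix)).1.
have mu0 := psim_ratio_neq0 f.
(* Near [x] the first curvatures differ by this constant factor, which cancels in the logarithmic
   derivative. *)
pose c := delta x / mu.
have c0 : c != 0 by rewrite mulf_neq0 ?invr_neq0 // tangent_sign_neq0.
have k'E y : I y -> delta y = delta x -> k' 1%N y = c * k 1%N y.
  move=> Iy dy; rewrite /c -dy /tangent_sign mulrAC divfK ?k1_neq0 //.
  by rewrite mulrAC divff // mul1r.
have PI := properI Ix.
have -> : derive_within I (k' 1%N : R -> R^o) x =
    c *: derive_within I (k 1%N : R -> R^o) x.
  apply: derive_within_scale => //; last exact: k'E.
  apply: filterS2 (near_increments_mem I x) (near_tangent_sign Ix) => h Ih dh.
  exact: k'E.
rewrite k'E // invfM /GRing.scale /= mulrA; congr (_ * _).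
by rewrite mulNr -mulrA [_^-1 * c]mulrC mulrA mulVf // mul1r.
Qed.

End SimilarCurves.

(** * Frenet frame and curvatures of the image curve *)

Section SimilarFrame.
Variables (R : realType) (n : nat) (f : p_similarity R n).

Local Notation m := `|psim_ratio f|.
Local Notation A := (psim_mx f).

Let m_gt0 : 0 < m. Proof. by rewrite normr_gt0 psim_ratio_neq0. Qed.

(** The linear part of [f] divided by the absolute value of its ratio: a Lorentzian isometry that
    sends unit tangents to unit tangents of the image curve. *)
Definition similar_vector (u : 'cV[R]_n) : 'cV[R]_n :=
  Num.sg (psim_ratio f) *: (A *m u).

Lemma lorentz_similar_vector u v :
  lorentz (similar_vector u) (similar_vector v) = lorentz u v.
Proof.
rewrite lorentzZ -expr2 sqr_sg psim_ratio_neq0 mul1r lorentz_mulmx //.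
exact: psim_mx_orthogonal.
Qed.

Lemma causal_sign_similar_vector u :
  causal_sign (similar_vector u) = causal_sign u.
Proof. exact/lorentz_causal_sign/lorentz_similar_vector. Qed.

Lemma similar_vectorZ a u : similar_vector (a *: u) = a *: similar_vector u.
Proof. by rewrite /similar_vector -scalemxAr !scalerA mulrC. Qed.

Lemma similar_vectorD u v :
  similar_vector (u + v) = similar_vector u + similar_vector v.
Proof. by rewrite /similar_vector mulmxDr scalerDr. Qed.

Lemma similar_orthonormal (e : nat -> 'cV[R]_n) :
  pseudo_orthonormal_frame e -> pseudo_orthonormal_frame (similar_vector \o e).
Proof.
move=> ee i j ii jj /=.
by rewrite lorentz_similar_vector ee // causal_sign_similar_vector.
Qed.

(** The isometry has determinant the [n]-th power of the sign of the ratio, which is 1 when [f]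
    preserves orientation; a nonzero square remains. *)
Lemma similar_same_orientation (e : nat -> 'cV[R]_n) :
  orientation_preserving f -> pseudo_orthonormal_frame e ->
  same_orientation e (similar_vector \o e).
Proof.
move=> ori ee; rewrite /same_orientation.
have -> : frame_mx (similar_vector \o e) =
    Num.sg (psim_ratio f) *: A *m frame_mx e.
  apply/matrixP => i j; rewrite -scalemxAl !mxE; congr (_ * _).
  by apply: eq_bigr => l _; rewrite !mxE.
rewrite det_mulmx detZ psim_det mulr1.
have -> : Num.sg (psim_ratio f) ^+ n = 1.
  move: ori; rewrite /orientation_preserving; case: ifP => [_ mu0|even_n _].
    by rewrite gtr0_sg // expr1n.
  rewrite -[X in _ ^+ X]odd_double_half even_n add0n -muln2 mulnC exprM sqr_sg.
  by rewrite psim_ratio_neq0 expr1n.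
by rewrite mul1r -expr2 exprn_even_gt0 //= det_frame_mx_neq0.
Qed.

Variables J J' : set R.
Hypothesis J'J : forall t, J' t -> J (m^-1 * t).
Hypothesis properJ' : forall t, J' t -> ProperFilter (increments J' t).

Lemma is_derive_within_rescale (M : 'M[R]_n) b (F : R -> 'cV[R]_n) (t : R) d :
  is_derive_within J F (m^-1 * t) d ->
  is_derive_within J' (fun t => M *m F (m^-1 * t) + b) t (m^-1 *: (M *m d)).
Proof.
move=> Fd; have m0 : m^-1 != 0 by rewrite invr_eq0 gt_eqF.
have md : is_derive_within J' ((fun y => m^-1 * y) : R -> R^o) t m^-1.
  exact: is_derive_within_mul.
exact: is_derive_within_comp J'J m0 md
  (is_derive_within_mulmx (A := M) b Fd).
Qed.

Lemma Ck_within_rescale (j : nat) (M : 'M[R]_n) b (F : R -> 'cV[R]_n) :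
  Ck_within j J F -> Ck_within j J' (fun t => M *m F (m^-1 * t) + b).
Proof.
elim: j M b F => [|j IH] M b F /=.
  move=> /subspace_continuousP FJ; apply/subspace_continuousP => t J't.
  apply: cvgD; last exact: cvg_cst.
  have st : m^-1 * y @[y --> within J' (nbhs t)] --> within J (nbhs (m^-1 * t)).
    move=> P; rewrite /within /= /prop_near1 => JP.
    have mt : m^-1 * y @[y --> t] --> m^-1 * t by exact: mulrl_continuous.
    change (nbhs t (fun y => J' y -> P (m^-1 * y))).
    have mP : nbhs t (fun y => J (m^-1 * y) -> P (m^-1 * y)) by exact: mt _ JP.
    by apply: filterS mP => y yP /J'J /yP.
  exact: mulmx_cvg (cvg_comp _ _ st (FJ _ (J'J J't))).
move=> [F' [FF' F'k]].
(* The derivative has the same shape with matrix [m^-1 *: M] and zero shift, hence the induction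
   over all [M] and [b]. *)
exists (fun t => (m^-1 *: M) *m F' (m^-1 * t) + 0); split; last exact: IH.
move=> t J't; rewrite addr0 -scalemxAl.
exact/is_derive_within_rescale/FF'/J'J.
Qed.

Lemma similar_derive_within (F : R -> 'cV[R]_n) (t : R) d :
  is_derive_within J F (m^-1 * t) d ->
  is_derive_within J' (fun t => similar_vector (F (m^-1 * t))) t
    (m^-1 *: similar_vector d).
Proof.
move=> Fd.
have := is_derive_within_rescale (M := Num.sg (psim_ratio f) *: A) 0 Fd.
rewrite /similar_vector -scalemxAl; congr (is_derive_within _ _ _ _).
by apply/funext => y; rewrite addr0 scalemxAl.
Qed.

(** Arc length is multiplied by [m], so derivatives, and with them curvatures, are divided by
    [m]. *)
Lemma frenet_arclength_similar (g : R -> 'cV[R]_n) E K :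
  frenet_arclength J g E K ->
  frenet_arclength J' (fun t => psim_map f (g (m^-1 * t)))
    (fun i t => similar_vector (E i (m^-1 * t)))
    (fun i t => K i (m^-1 * t) / m).
Proof.
move=> [gC EE gE E1 Ei En EK Kpos Kn0].
have mapE : (fun t => psim_map f (g (m^-1 * t))) =
    fun t => psim_ratio f *: A *m g (m^-1 * t) + psim_shift f.
  by apply/funext => t; rewrite /psim_map /psim_linear scalemxAl.
split.
- by rewrite mapE; exact: Ck_within_rescale.
- by move=> t J't; exact/similar_orthonormal/EE/J'J.
- move=> t J't; rewrite mapE.
  have := is_derive_within_rescale (M := psim_ratio f *: A) (psim_shift f)
    (gE _ (J'J J't)).
  congr (is_derive_within _ _ _ _).
  rewrite /similar_vector -scalemxAl scalerA; congr (_ *: _).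
  by rewrite {2}[psim_ratio f]numEsg mulrC mulfK ?gt_eqF.
- move=> t J't.
  have := similar_derive_within (E1 _ (J'J J't)).
  congr (is_derive_within _ _ _ _).
  rewrite similar_vectorZ causal_sign_similar_vector scalerA.
  by congr (_ *: _); ring.
- move=> i t ii J't.
  have := similar_derive_within (Ei _ _ ii (J'J J't)).
  congr (is_derive_within _ _ _ _).
  rewrite similar_vectorD !similar_vectorZ !causal_sign_similar_vector.
  by rewrite scalerDr !scalerA; congr (_ *: _ + _ *: _); ring.
- move=> t J't.
  have := similar_derive_within (En _ (J'J J't)).
  congr (is_derive_within _ _ _ _).
  rewrite similar_vectorZ causal_sign_similar_vector scalerA.
  by congr (_ *: _); ring.
- move=> i t d ii J't dE'.
  (* The original Frenet equations supply a derivative; uniqueness identifies its image with the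
     given [d]. *)
  have [D ED] : exists D, is_derive_within J (E i) (m^-1 * t) D.
    have [i1|i1] := eqVneq i 1%N.
      by rewrite i1; eexists; exact: E1 (J'J J't).
    have i2 : (2 <= i <= n.-1)%N by lia.
    by eexists; exact: Ei i2 (J'J J't).
  have PJ' := properJ' J't.
  rewrite (EK _ _ _ ii (J'J J't) ED).
  rewrite (is_derive_within_unique PJ' dE' (similar_derive_within ED)).
  rewrite -[similar_vector (E i.+1 _)]scale1r lorentzZ lorentz_similar_vector.
  by rewrite mulr1 mulrC.
- by move=> j t jj J't; rewrite divr_gt0 // Kpos //; exact: J'J.
- move=> t J't; apply: mulf_neq0; last by rewrite invr_eq0 gt_eqF.
  exact/Kn0/J'J.
Qed.

End SimilarFrame.

(** With arc length multiplied and curvature divided by the same number, the product of first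
    curvature and arc length element is unchanged, so the spherical parameter is kept. *)
Lemma frenet_spherical_similar (R : realType) (n : nat) (I : set R)
    (f : p_similarity R n) alpha e k : (2 <= n)%N ->
  (forall x, I x -> ProperFilter (increments I x)) ->
  frenet_spherical I alpha e k ->
  frenet_spherical I (psim_map f \o alpha)
    (fun i x => similar_vector f (e i x)) (fun i x => k i x / `|psim_ratio f|).
Proof.
move=> n2 properI h; have eqs := frenet_spherical_equations n2 h.
case: h => [s [g [E [K [gEK sE ind s']]]]].
set m : R := `|psim_ratio f|.
have m0 : m != 0 by rewrite normr_eq0 psim_ratio_neq0.
have mK (y : R) : m^-1 * (m * y) = y by rewrite mulKf.
have i1 : (1 <= 1 <= n.-1)%N by lia.
have k0 x : I x -> (k 1%N x / m)^-1 != 0.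
  by move=> Ix; rewrite invr_eq0 mulf_neq0 ?invr_eq0 // (spherical_neq0 eqs).
have sd x : I x ->
    is_derive_within I ((fun y => m * s y) : R -> R^o) x (k 1%N x / m)^-1.
  move=> Ix; have := is_derive_within_scaling (m := m) (s' _ Ix).
  by congr (is_derive_within _ _ _ _); rewrite invfM invrK mulrC.
exists (fun x => m * s x), (fun t => psim_map f (g (m^-1 * t))),
  (fun i t => similar_vector f (E i (m^-1 * t))),
  (fun i t => K i (m^-1 * t) / m).
split=> //.
- apply: frenet_arclength_similar gEK.
    by move=> _ [x Ix <-]; rewrite mK; exists x.
  move=> _ [x Ix <-].
  apply: (increments_proper_image _ (k0 _ Ix) (sd _ Ix) (properI _ Ix)).
  by move=> y Iy; exists y.
- move=> x Ix; have [ag eE kK] := sE _ Ix.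
  by rewrite mK; split=> [|i ii|i ii]; rewrite /= ?ag ?eE ?kK.
- move=> x Ix; have [v ev v1] := ind _ Ix.
  exists (similar_vector f v); last by rewrite /lnorm lorentz_similar_vector.
  have := is_derive_within_mulmx (A := Num.sg (psim_ratio f) *: psim_mx f) 0 ev.
  rewrite /similar_vector -scalemxAl; congr (is_derive_within _ _ _ _).
  by apply/funext => y; rewrite addr0 scalemxAl.
Qed.

Theorem proposition3 (R : realType) (n : nat) (hn : (2 <= n)%N)
    (I : set R) (I_interval : is_interval I)
    (I_nontrivial : exists a b : R, [/\ I a, I b & a < b])
    (alpha : R -> 'cV[R]_n) (e : nat -> R -> 'cV[R]_n) (k : nat -> R -> R)
    (h_alpha : frenet_spherical I alpha e k)
    (f : p_similarity R n) (hf : orientation_preserving f) :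
  [/\ forall sigma, I sigma ->
        pseudo_orthogonal_frame (similarity_frame e k ^~ sigma),
      exists (e' : nat -> R -> 'cV[R]_n) (k' : nat -> R -> R),
        frenet_spherical I (psim_map f \o alpha) e' k' /\
        (forall sigma, I sigma -> same_orientation (e ^~ sigma) (e' ^~ sigma)) &
      forall (e' : nat -> R -> 'cV[R]_n) (k' : nat -> R -> R),
        frenet_spherical I (psim_map f \o alpha) e' k' ->
        (forall sigma, I sigma ->
           same_orientation (e ^~ sigma) (e' ^~ sigma)) ->
        forall sigma, I sigma ->
          (forall i, (1 <= i <= n)%N ->
             psim_linear f (similarity_frame e k i sigma) =
             similarity_frame e' k' i sigma) /\
          (forall i, (1 <= i <= n.-1)%N ->
             similarity_curvature I k i sigma =
             similarity_curvature I k' i sigma)].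
Proof.
have eqs := frenet_spherical_equations hn h_alpha.
have properI := is_interval_increments I_interval I_nontrivial.
have h1 : (1 <= 1 <= n.-1)%N by lia.
split.
- move=> x Ix i j ii jj.
  rewrite /similarity_frame lorentzZ (spherical_orthonormal eqs) //.
  have kk : (k 1%N x)^-1 * (k 1%N x)^-1 != 0.
    by rewrite mulf_neq0 ?invr_eq0 ?(spherical_neq0 eqs).
  rewrite mulf_eq0 (negbTE kk) /=; case: (i == j); last by rewrite eqxx.
  by rewrite (negbTE (causal_sign_neq0 _)).
(* The transported frame is a witness, so the last clause is not vacuous. *)
- exists (fun i x => similar_vector f (e i x)),
    (fun i x => k i x / `|psim_ratio f|).
  split; first exact: frenet_spherical_similar.
  move=> x Ix; apply: similar_same_orientation => //.
  exact: spherical_orthonormal eqs _ Ix.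
- move=> e' k' h' ori x Ix.
  have eqs' := frenet_spherical_equations hn h'.
  split=> i ii.
    exact: (similar_similarity_frame hn properI eqs eqs').
  exact: (similar_similarity_curvature hn properI eqs eqs').
Qed.
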